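(* For every integer $n\ge 0$, $R_3(n)=\bar{O}_2(n)$, and $$\bar{O}_2(n)\equiv P(d,n)\equiv\begin{cases}1 \pmod 2 & \text{if } n=\frac{m(3m-1)}{2}\text{ for some } m\in\mathbb{Z},\\ 0\pmod 2 & \text{if } n\ne\frac{m(3m-1)}{2}\text{ for all } m\in\mathbb{Z}.\end{cases}$$
   Context: A 3-color partition of $n$ is a finite multiset of positive integers (parts), each carrying one of the colors $color(1),color(2),color(3)$, whose sum is $n$. $R_3(n)$ is the number of 3-color partitions of $n$ in which even parts occur only in $color(2)$ and $color(3)$ and in which parts of the same color do not repeat (equal integers in different colors are allowed). Thus $\sum_{n\ge0} R_3(n)q^n=\prod_{j\ge1}(1+q^{2j-1})^3(1+q^{2j})^2$. $\bar{O}_2(n)$ is the number of partitions of $n$ into odd parts, each carrying one of two colors $color(1),color(2)$, in which parts of $color(2)$ may be overlined in the sense of overpartitions (for each part size, the first occurrence of that size in $color(2)$ may or may not be overlined). Thus $\sum_{n\ge0}\bar{O}_2(n)q^n=\prod_{j\ge1}\frac{1+q^{2j-1}}{(1-q^{2j-1})^2}$. $P(d,n)$ is the number of partitions of $n$ into distinct parts. *)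

(* Defs.v *)
From HB Require Import structures.
From mathcomp Require Import all_boot all_order all_algebra.

Set Implicit Arguments.
Unset Strict Implicit.
Unset Printing Implicit Defensive.

(* A finite multiset of parts in {1, ..., n}, given by its multiplicities:
   [p i] is the number of occurrences of the part [i.+1].  In a partition of
   [n] every part and every multiplicity is at most [n], so the bounds on both
   lose nothing. *)
Definition parts (n : nat) : Type := {ffun 'I_n -> 'I_n.+1}.
HB.instance Definition _ n := Finite.on (parts n).

Definition weight (n : nat) (p : parts n) : nat := \sum_(i < n) i.+1 * p i.

Definition occurs (n : nat) (p : parts n) (i : 'I_n) : bool := 0 < p i.

Definition distinct_parts (n : nat) (p : parts n) : bool :=
  [forall i, p i <= 1].

(* [f c] is the multiset of the parts in one color; color(1), color(2), ... are
   the ordinals 0, 1, .... *)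
Definition colored_parts (k n : nat) : Type := {ffun 'I_k -> parts n}.
HB.instance Definition _ k n := Finite.on (colored_parts k n).

Definition colored_partition (k n : nat) (f : colored_parts k n) : bool :=
  \sum_(c < k) weight (f c) == n.

Definition R3 (n : nat) : nat :=
  #|[set f : colored_parts 3 n |
      [&& colored_partition f,
          [forall c : 'I_3, forall i : 'I_n,
             occurs (f c) i && ~~ odd i.+1 ==> (c == 1 :> nat) || (c == 2 :> nat)]
        & [forall c, distinct_parts (f c)]]]|.

(* Only the first occurrence of a part size in color(2) can be overlined, so
   the overlining is a set of part sizes occurring in color(2). *)
Definition O2bar (n : nat) : nat :=
  #|[set fo : colored_parts 2 n * {set 'I_n} |
      [&& colored_partition fo.1,
          [forall c : 'I_2, forall i : 'I_n, occurs (fo.1 c) i ==> odd i.+1]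
        & [forall i in fo.2, occurs (fo.1 ord_max) i]]]|.

Definition Pd (n : nat) : nat :=
  #|[set p : parts n | (weight p == n) && distinct_parts p]|.

(* Main.v *)
(* All identities are between polynomials truncated at degree n.  Write
   A = prod_j (1 + q^j), and B, C for the products of 1 - q^j and 1 + q^j over
   odd j.  The generating function of R3 is C A^2 and that of O2bar is C / B^2;
   they agree by Euler's identity A B = 1.  Modulo 2 we have C = B, so
   C A^2 = A, which counts partitions into distinct parts, and A is congruent to
   prod_j (1 - q^j), whose coefficients are read off Shanks' finite form of
   the pentagonal number theorem. *)
Require Import Defs.
From mathcomp Require Import all_boot all_order all_algebra.
From mathcomp Require Import zify ring.

Set Implicit Arguments.
Unset Strict Implicit.
Unset Printing Implicit Defensive.

Import GRing.Theory Num.Theory.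
Local Open Scope ring_scope.

(** * Finite product identities *)

(** Since (1 + q^j)(1 - q^j) = 1 - q^(2j), the even factors up to [n] cancel and those from [n + 1]
    to [2n] remain. Induction on [n] avoids dividing in [R]. *)
Lemma euler_odd_distinct_finite (R : comNzRingType) (q : R) (n : nat) :
  (\prod_(i < n) (1 + q ^+ i.+1)) * (\prod_(i < n | odd i.+1) (1 - q ^+ i.+1))
  = \prod_(n <= i < n.*2 | ~~ odd i.+1) (1 - q ^+ i.+1).
Proof.
elim: n => [|n IHn]; first by rewrite !big_ord0 big_geq ?mulr1.
rewrite big_ord_recr [X in _ * X]big_mkcond big_ord_recr -big_mkcond /=.
have e2 : q ^+ n.*2.+2 = q ^+ n.+1 * q ^+ n.+1.
  by rewrite -exprD; congr (_ ^+ _); lia.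
have -> : \prod_(n.+1 <= i < n.+1.*2 | ~~ odd i.+1) (1 - q ^+ i.+1)
   = \prod_(n.+1 <= i < n.*2.+1 | ~~ odd i.+1) (1 - q ^+ i.+1)
     * (1 - q ^+ n.+1 * q ^+ n.+1).
  rewrite doubleS big_mkcond big_nat_recr /=; last by lia.
  by rewrite -big_mkcond odd_double e2.
(* The top index [n.*2] carries the odd exponent [2n + 1], so it contributes nothing. *)
have -> : \prod_(n.+1 <= i < n.*2.+1 | ~~ odd i.+1) (1 - q ^+ i.+1)
   = \prod_(n.+1 <= i < n.*2 | ~~ odd i.+1) (1 - q ^+ i.+1).
  case: (leqP n.+1 n.*2) => hn; last by rewrite !big_geq //; lia.
  by rewrite big_mkcond big_nat_recr //= -big_mkcond odd_double mulr1.
rewrite mulrACA IHn {IHn e2}.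
have [n0|n_gt0] := posnP n.
  by rewrite n0 !big_geq //=; ring.
have -> : \prod_(n <= i < n.*2 | ~~ odd i.+1) (1 - q ^+ i.+1)
   = (if ~~ odd n.+1 then 1 - q ^+ n.+1 else 1)
     * \prod_(n.+1 <= i < n.*2 | ~~ odd i.+1) (1 - q ^+ i.+1).
  by rewrite big_mkcond big_ltn -?big_mkcond //; lia.
by rewrite /=; case: (odd n) => /=; ring.
Qed.

(* With j = k.+1, the two exponents on the right are j(3j-1)/2 and j(3j+1)/2. *)
Lemma shanks_pentagonal (R : comNzRingType) (q : R) (n : nat) :
  \sum_(0 <= k < n.+1)
     (-1) ^+ k * (\prod_(k <= s < n) (1 - q ^+ s.+1)) * q ^+ (k * n + 'C(k.+1, 2))
  = 1 + \sum_(0 <= k < n) (-1) ^+ k.+1 *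
      (q ^+ (3 * 'C(k.+1, 2) + k.+1) + q ^+ (3 * 'C(k.+1, 2) + 2 * k.+1)).
Proof.
elim: n => [|n IHn].
  by rewrite big_nat1 !big_geq // mul0n bin_small // !expr0 !mulr1 addr0.
rewrite [in RHS]big_nat_recr //= addrA -IHn big_nat_recr //=.
rewrite (big_geq (leqnn n.+1)).
pose Q k := (-1) ^+ k * \prod_(k <= s < n) (1 - q ^+ s.+1).
(* [b k] arises in two ways: from the new factor 1 - q^(n+1) in the term [k], and from raising [n]
   to [n.+1] in the exponent of the term [k.+1]. The two sums of [b] cancel except for [b n]. *)
pose b k := Q k * q ^+ (k.+1 * n.+1 + 'C(k.+1, 2)).
have step k : (k < n.+1)%N ->
   (-1) ^+ k * (\prod_(k <= s < n.+1) (1 - q ^+ s.+1)) * q ^+ (k * n.+1 + 'C(k.+1, 2))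
   = Q k * q ^+ (k * n.+1 + 'C(k.+1, 2)) - b k.
  move=> kn; rewrite big_nat_recr //= /b /Q mulSn -addnA.
  by move: (k * n.+1 + 'C(k.+1, 2))%N => e; rewrite exprD; ring.
rewrite (eq_big_nat _ _ (F2 := fun k => Q k * q ^+ (k * n.+1 + 'C(k.+1, 2)) - b k));
  last by move=> k /andP[_]; exact: step.
rewrite sumrB.
have tele : \sum_(0 <= k < n.+1) Q k * q ^+ (k * n + 'C(k.+1, 2))
   = \sum_(0 <= k < n.+1) Q k * q ^+ (k * n.+1 + 'C(k.+1, 2))
     - \sum_(0 <= k < n) b k.
  rewrite !(big_nat_recl n 0) //= !mul0n -addrA; congr (_ + _).
  rewrite -sumrB; apply: eq_big_nat => k /andP[_ kn].
  (* Splitting the lowest factor off [Q k] leaves [Q k.+1] with the opposite sign. *)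
  have -> : b k = - (Q k.+1 * (1 - q ^+ k.+1) * q ^+ (k.+1 * n.+1 + 'C(k.+1, 2))).
    by rewrite /b /Q big_ltn // (exprS (-1)); ring.
  have -> : (k.+1 * n + 'C(k.+2, 2) = k.+1 * n.+1 + 'C(k.+1, 2))%N.
    by rewrite binS bin1; lia.
  have -> : (k.+1 * n.+1 + 'C(k.+2, 2) = k.+1 + (k.+1 * n.+1 + 'C(k.+1, 2)))%N.
    by rewrite (binS k.+1) bin1; lia.
  move: (k.+1 * n.+1 + 'C(k.+1, 2))%N => e; rewrite exprD; ring.
rewrite tele [\sum_(0 <= k < n.+1) b k]big_nat_recr //= {tele step}.
have C2 := mul_bin_diag n.+1 1; rewrite bin1 in C2.
(* The surviving [b n] and the new term at [n.+1] supply the two new pentagonal exponents. *)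
have -> : b n = (-1) ^+ n * q ^+ (3 * 'C(n.+1, 2) + n.+1).
  rewrite /b /Q big_geq // mulr1; congr (_ * q ^+ _); lia.
have -> : (n.+1 * n.+1 + 'C(n.+2, 2) = 3 * 'C(n.+1, 2) + 2 * n.+1)%N.
  by rewrite (binS n.+1) bin1; lia.
rewrite (exprS (-1)); ring.
Qed.

(** * Truncated polynomials *)

(** Congruence modulo ['X^(n.+1)]. *)
Definition eq_upto (R : nzSemiRingType) (n : nat) (p q : {poly R}) : Prop :=
  forall i, (i <= n)%N -> p`_i = q`_i.

Lemma eq_uptoM (R : nzSemiRingType) (n : nat) (p p' q q' : {poly R}) :
  eq_upto n p p' -> eq_upto n q q' -> eq_upto n (p * q) (p' * q').
Proof.
move=> pp qq i ile; rewrite !coefM; apply: eq_bigr => j _.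
rewrite pp ?qq //; first exact: leq_trans (leq_subr _ _) ile.
by apply: leq_trans ile; rewrite -ltnS.
Qed.

Lemma eq_upto_prod (R : nzSemiRingType) (n : nat) (I : Type) (r : seq I)
    (P : pred I) (F G : I -> {poly R}) :
  (forall i, P i -> eq_upto n (F i) (G i)) ->
  eq_upto n (\prod_(i <- r | P i) F i) (\prod_(i <- r | P i) G i).
Proof. by move=> FG; elim/big_rec2: _ => // i p q Pi; apply: eq_uptoM; exact: FG. Qed.

Lemma eq_upto_subMXn (R : nzRingType) (n m : nat) (p q : {poly R}) :
  (n < m)%N -> eq_upto n (p - q * 'X^m) p.
Proof.
by move=> nm i ile; rewrite coefB coefMXn (leq_ltn_trans ile nm) subr0.
Qed.

Lemma eq_upto_trans (R : nzSemiRingType) (n : nat) (p q r : {poly R}) :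
  eq_upto n p q -> eq_upto n q r -> eq_upto n p r.
Proof. by move=> pq qr i ile; rewrite pq ?qr. Qed.

(** * Generating functions of the three counts *)

Definition distinctGF (R : nzSemiRingType) (n : nat) : {poly R} :=
  \prod_(i < n) (1 + 'X^(i.+1)).

Definition oddDistinctGF (R : nzSemiRingType) (n : nat) : {poly R} :=
  \prod_(i < n | odd i.+1) (1 + 'X^(i.+1)).

(** The reciprocal of the generating function of partitions into odd parts of size at most [n];
    unlike that series, it is a polynomial. *)
Definition oddInvGF (R : nzRingType) (n : nat) : {poly R} :=
  \prod_(i < n | odd i.+1) (1 - 'X^(i.+1)).

(** Every factor left over in the finite Euler identity has the form 1 - q^j with j > n. *)
Lemma distinctGF_oddInvGF (R : comNzRingType) (n : nat) :
  eq_upto n (distinctGF R n * oddInvGF R n) 1.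
Proof.
rewrite /distinctGF /oddInvGF euler_odd_distinct_finite big_nat_cond.
apply: (@eq_upto_trans _ _ _
    (\prod_(n <= i < n.*2 | (n <= i < n.*2)%N && ~~ odd i.+1) 1));
  last by rewrite big1_eq.
apply: eq_upto_prod => i /andP[/andP[ni _] _].
by rewrite -['X^_]mul1r; exact: eq_upto_subMXn.
Qed.

(** The ring stays arbitrary because counts are compared exactly over [int] and modulo 2 over
    ['F_2]. *)
Lemma card_coef_sum (R : nzSemiRingType) (T : finType) (P : pred T)
    (w : T -> nat) (n : nat) :
  #|[set x | (w x == n) && P x]|%:R = (\sum_(x | P x) 'X^(w x) : {poly R})`_n.
Proof.
rewrite -sum1_card natr_sum coef_sum.
under eq_bigl => x do rewrite inE andbC.
by rewrite big_mkcondr; apply: eq_bigr => x _; rewrite coefXn eq_sym; case: eqP.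
Qed.

Lemma Xn_weight (R : nzSemiRingType) (n : nat) (p : parts n) :
  'X^(weight p) = \prod_(i < n) 'X^(i.+1 * p i) :> {poly R}.
Proof. by rewrite /weight (big_morph _ (exprD 'X) (expr0 'X)). Qed.

Lemma sum_le1 (R : nzSemiRingType) (n : nat) (i : 'I_n) :
  \sum_(m < n.+1 | (m <= 1)%N) 'X^(i.+1 * m) = 1 + 'X^(i.+1) :> {poly R}.
Proof.
(* An index in ['I_n] forces [n] to be positive, so the multiplicity 1 is in range. *)
case: n i => [[]//|k] i.
rewrite big_mkcond !big_ord_recl /= muln0 muln1 big1 ?addr0 //.
Qed.

Lemma sum_le0 (R : nzSemiRingType) (n : nat) (i : nat) :
  \sum_(m < n.+1 | m == 0%N :> nat) 'X^(i.+1 * m) = 1 :> {poly R}.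
Proof. by rewrite big_mkcond big_ord_recl /= muln0 big1 ?addr0. Qed.

Lemma Pd_coef (R : comNzRingType) (n : nat) : (Pd n)%:R = (distinctGF R n)`_n.
Proof.
rewrite /Pd card_coef_sum; congr (polyseq _)`_n.
under eq_bigr => p _ do rewrite Xn_weight.
rewrite /distinctGF; under [in RHS]eq_bigr => i _ do rewrite -sum_le1.
rewrite bigA_distr_big_dep; apply: eq_bigl => p.
by apply/forallP/familyP => h i; exact: h i.
Qed.

(** Distributivity applied twice, over the sizes within a color and then over the colors. It serves
    any constraint that treats each color and size separately. *)
Lemma sum_colored_parts (R : comNzRingType) (k n : nat)
    (Q : 'I_k -> 'I_n -> pred 'I_n.+1) (F : 'I_k -> 'I_n -> 'I_n.+1 -> R) :
  \sum_(f : colored_parts k n | [forall c, forall i, Q c i (f c i)])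
     \prod_(c < k) \prod_(i < n) F c i (f c i)
  = \prod_(c < k) \prod_(i < n) \sum_(m | Q c i m) F c i m.
Proof.
under [in RHS]eq_bigr => c _ do rewrite bigA_distr_big_dep.
rewrite bigA_distr_big_dep; apply: eq_bigl => f.
apply/'forall_forallP/familyP => [h c|h c i].
  by apply/familyP => i; apply: h.
by have /familyP/(_ i) := h c.
Qed.

Lemma R3_coef (R : comNzRingType) (n : nat) :
  (R3 n)%:R = (oddDistinctGF R n * distinctGF R n ^+ 2)`_n.
Proof.
rewrite /R3 /colored_partition card_coef_sum; congr (polyseq _)`_n.
(* Both constraints merge into one on each multiplicity: 0 for an even size in color(1), which is
   the ordinal 0, and at most 1 otherwise. *)
pose Q (c : 'I_3) (i : 'I_n) (m : 'I_n.+1) :=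
  (if odd i.+1 || (c != 0 :> nat) then (m <= 1)%N else m == 0%N :> nat).
pose F (c : 'I_3) (i : 'I_n) (m : 'I_n.+1) : {poly R} := 'X^(i.+1 * m).
transitivity (\sum_(f : colored_parts 3 n | [forall c, forall i, Q c i (f c i)])
     \prod_(c < 3) \prod_(i < n) F c i (f c i)).
  apply: eq_big => f; last first.
    move=> _; rewrite (big_morph _ (exprD 'X) (expr0 'X)).
    by apply: eq_bigr => c _; exact: Xn_weight.
  apply/andP/'forall_forallP => [[/'forall_forallP h1 /'forall_forallP h2] c i|h].
    move: (h1 c i) (h2 c i); rewrite /Q /occurs.
    case: (odd i.+1); first by rewrite andbF.
    by case: c => -[|[|[|c]]] c3 //=; case: (f _ i) => -[].
  split; apply/'forall_forallP => c i; move: (h c i); rewrite /Q /occurs.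
    case: (odd i.+1); first by rewrite andbF.
    by case: c => -[|[|[|c]]] c3 //=; case: (f _ i) => -[].
  by case: ifP => // _ /eqP ->.
rewrite sum_colored_parts !big_ord_recl big_ord0 mulr1 expr2; congr (_ * (_ * _)).
- rewrite /oddDistinctGF [in RHS]big_mkcond; apply: eq_bigr => i _.
  by rewrite /Q /F orbF; case: (odd i.+1); rewrite ?sum_le1 ?sum_le0.
- by apply: eq_bigr => i _; rewrite /Q /F orbT sum_le1.
- by apply: eq_bigr => i _; rewrite /Q /F orbT sum_le1.
Qed.

Definition geomGF (R : nzSemiRingType) (n i : nat) : {poly R} :=
  \sum_(m < n.+1) 'X^(i.+1 * m).

(* A part size that occurs can be overlined or not, hence the factor 2. *)
Definition overGF (R : nzSemiRingType) (n i : nat) : {poly R} :=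
  \sum_(m < n.+1) (if (0 < m)%N then 2 else 1) * 'X^(i.+1 * m).

(** The error exponent exceeds [n], so [geomGF] inverts [1 - 'X^(i.+1)] up to degree [n]. *)
Lemma geomGF_mul (R : comNzRingType) (n i : nat) :
  geomGF R n i * (1 - 'X^(i.+1)) = 1 - 'X^(i.+1 * n.+1).
Proof.
rewrite /geomGF; under eq_bigr => m _ do rewrite exprM.
by rewrite -opprB mulrN mulrC -subrX1 opprB exprM.
Qed.

(** Doubling the geometric sum overcounts only the multiplicity 0, by one. *)
Lemma overGF_geomGF (R : comNzRingType) (n i : nat) :
  overGF R n i = 2 * geomGF R n i - 1.
Proof.
rewrite /overGF /geomGF !big_ord_recl /= -mulr_sumr muln0 expr0; ring.
Qed.

Lemma O2bar_coef (R : comNzRingType) (n : nat) :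
  (O2bar n)%:R = ((\prod_(i < n | odd i.+1) geomGF R n i)
                  * \prod_(i < n | odd i.+1) overGF R n i)`_n.
Proof.
rewrite /O2bar /colored_partition card_coef_sum; congr (polyseq _)`_n.
pose Q (c : 'I_2) (i : 'I_n) (m : 'I_n.+1) := (0 < m)%N ==> odd i.+1.
pose F (c : 'I_2) (i : 'I_n) (m : 'I_n.+1) : {poly R} :=
  (if (c == ord_max) && (0 < m)%N then 2 else 1) * 'X^(i.+1 * m).
transitivity (\sum_(f : colored_parts 2 n | [forall c, forall i, Q c i (f c i)])
     \prod_(c < 2) \prod_(i < n) F c i (f c i)).
  (* For fixed parts, the overlinings are the subsets of the sizes occurring in color(2). Their
     number, a power of 2, is then spread as one factor 2 per occurring size. *)
  rewrite -(pair_big_dep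
    (fun f : colored_parts 2 n => [forall c, forall i, Q c i (f c i)])
    (fun f (o : {set 'I_n}) => [forall i in o, occurs (f ord_max) i])
    (fun f _ => 'X^(\sum_(c < 2) weight (f c)))) /=.
  apply: eq_bigr => f _; rewrite sumr_const.
  have -> : #|[pred o : {set 'I_n} | [forall i in o, occurs (f ord_max) i]]|
      = (2 ^ #|[set i | occurs (f ord_max) i]|)%N.
    rewrite -card_powerset; apply: eq_card => o; rewrite !inE.
    apply/forall_inP/subsetP => h i io; last by have := h i io; rewrite inE.
    by rewrite inE h.
  rewrite !big_ord_recl !big_ord0 mulr1 addn0 exprD !Xn_weight.
  have e1 : lift ord0 ord0 = ord_max :> 'I_2 by apply: val_inj.
  rewrite e1 -mulr_natr -mulrA; congr (_ * _).
    by apply: eq_bigr => i _; rewrite /F mul1r.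
  rewrite mulrC natrX -prodr_const big_mkcond -big_split.
  by apply: eq_bigr => i _; rewrite /F inE eqxx.
(* An even size admits only the multiplicity 0, which contributes 1. *)
have sum_Q c (G : 'I_n -> 'I_n.+1 -> {poly R}) (i : 'I_n) : G i ord0 = 1 ->
   \sum_(m | Q c i m) G i m = if odd i.+1 then \sum_m G i m else 1.
  rewrite /Q; case: (odd i.+1) => G0; first by apply: eq_bigl => m; rewrite implybT.
  by rewrite big_mkcond big_ord_recl /= G0 big1 ?addr0.
rewrite sum_colored_parts !big_ord_recl big_ord0 mulr1; congr (_ * _);
  rewrite [in RHS]big_mkcond; apply: eq_bigr => i _;
  rewrite sum_Q /F ?muln0 ?mul1r //; case: (odd i.+1) => //.
by apply: eq_bigr => m _; rewrite mul1r.
Qed.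

Lemma R3_O2bar (n : nat) : R3 n = O2bar n.
Proof.
suff: (R3 n)%:R = (O2bar n)%:R :> int by move/eqP; rewrite eqr_nat => /eqP.
rewrite R3_coef O2bar_coef.
set A := distinctGF _ n; set C := oddDistinctGF _ n.
set G := \prod_(i < n | _) _; set V := \prod_(i < n | _) _.
pose B := oddInvGF int n.
have AB : eq_upto n (A * B) 1 by exact: distinctGF_oddInvGF.
have GB : eq_upto n (G * B) 1.
  rewrite /G /B /oddInvGF -big_split.
  apply: (@eq_upto_trans _ _ _ (\prod_(i < n | odd i.+1) 1));
  last by rewrite big1_eq.
  apply: eq_upto_prod => i _ /=; rewrite geomGF_mul -['X^_]mul1r.
  by apply: eq_upto_subMXn; nia.
have VB : eq_upto n (V * B) C.
  rewrite /V /B /C /oddInvGF /oddDistinctGF -big_split.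
  apply: eq_upto_prod => i _ /=.
  have -> : overGF int n i * (1 - 'X^(i.+1)) = 1 + 'X^(i.+1) - 2 * 'X^(i.+1 * n.+1).
    by rewrite overGF_geomGF mulrBl -mulrA geomGF_mul; ring.
  by apply: eq_upto_subMXn; nia.
(* Both sides meet at [C * (G * A)] up to degree [n]: the left after inserting [G * B] and
   cancelling [A * B], the right after inserting [A * B] and replacing [V * B] by [C]. *)
transitivity ((C * A ^+ 2 * (G * B))`_n).
  by rewrite -[in LHS](mulr1 (C * _)); apply/esym; apply: (eq_uptoM _ GB).
have -> : C * A ^+ 2 * (G * B) = C * (G * A * (A * B)) by ring.
have -> : (G * V)`_n = ((V * B) * (G * A * 1))`_n.
  have -> : V * B * (G * A * 1) = (G * V) * (A * B) by ring.
  by rewrite -[in LHS](mulr1 (G * V)); apply/esym; apply: (eq_uptoM _ AB).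
by apply/esym; apply: (eq_uptoM VB) => //; apply: eq_uptoM => // i ile; rewrite AB.
Qed.

(** * Parity *)

Lemma poly_F2_opp (p : {poly 'F_2}) : - p = p.
Proof.
by apply/polyP => i; rewrite coefN; apply: oppr_pchar2; exact: pchar_Fp.
Qed.

Lemma eq_F2_mod2 (m k : nat) : (m%:R = k%:R :> 'F_2) <-> m = k %[mod 2].
Proof.
split=> [/(congr1 val)|e]; first by rewrite /= !val_Fp_nat.
by apply/val_inj; rewrite /= !val_Fp_nat.
Qed.

Lemma R3_Pd_mod2 (n : nat) : R3 n = Pd n %[mod 2].
Proof.
apply/eq_F2_mod2; rewrite R3_coef Pd_coef.
have -> : oddDistinctGF 'F_2 n = oddInvGF 'F_2 n.
  by apply: eq_bigr => i _; rewrite poly_F2_opp.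
rewrite expr2 mulrA [_ * distinctGF _ n in X in X * _]mulrC.
rewrite -[in RHS](mul1r (distinctGF _ n)).
by apply: (eq_uptoM (@distinctGF_oddInvGF _ n)).
Qed.

(** * Pentagonal numbers and the parity of [Pd] *)

Lemma coef_pentagonal (R : comNzRingType) (n : nat) :
  (\prod_(i < n) (1 - 'X^(i.+1)) : {poly R})`_n =
  (n == 0%N)%:R + \sum_(0 <= k < n) (-1) ^+ k.+1 *
    ((n == 3 * 'C(k.+1, 2) + k.+1)%N%:R + (n == 3 * 'C(k.+1, 2) + 2 * k.+1)%N%:R).
Proof.
have /(congr1 (fun p : {poly R} => p`_n)) := shanks_pentagonal ('X : {poly R}) n.
(* In Shanks' sum the term at 0 is the product itself; every later term is a multiple of a power of
   ['X] above [n]. *)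
rewrite big_nat_recl // expr0 mul1r mul0n bin_small // expr0 mulr1 big_mkord.
rewrite coefD coef_sum [X in _ + X = _]big1_seq ?addr0 => [->|k _]; last first.
  by rewrite coefMXn; case: ltnP => //; have := bin_gt0 k.+2 2; nia.
rewrite coefD coef1 coef_sum; congr (_ + _); apply: eq_bigr => k _.
have -> : (-1) ^+ k.+1 = ((-1) ^+ k.+1)%:P :> {poly R} by rewrite rmorphXn rmorphN1.
by rewrite coefCM coefD !coefXn.
Qed.

Lemma Pd_pentagonal (n : nat) :
  (Pd n)%:R = (n == 0%N)%:R + \sum_(0 <= k < n)
    ((n == 3 * 'C(k.+1, 2) + k.+1)%N%:R + (n == 3 * 'C(k.+1, 2) + 2 * k.+1)%N%:R)
  :> 'F_2.
Proof.
have N1 : -1 = 1 :> 'F_2 by apply: oppr_pchar2; exact: pchar_Fp.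
rewrite Pd_coef.
have -> : distinctGF 'F_2 n = \prod_(i < n) (1 - 'X^(i.+1)).
  by apply: eq_bigr => i _; rewrite poly_F2_opp.
rewrite coef_pentagonal; congr (_ + _); apply: eq_bigr => k _.
by rewrite N1 expr1n mul1r.
Qed.

Lemma triangular_double (k : nat) : ('C(k.+1, 2) * 2 = k.+1 * k)%N.
Proof. by rewrite mulnC -mul_bin_diag bin1. Qed.

(** The generalized pentagonal numbers are pairwise distinct, so exactly one indicator in the sum
    equals 1. *)
Lemma Pd_pentagonal_index (n k : nat) :
  n = (3 * 'C(k.+1, 2) + k.+1)%N \/ n = (3 * 'C(k.+1, 2) + 2 * k.+1)%N ->
  Pd n = 1 %[mod 2].
Proof.
move=> nk; apply/(eq_F2_mod2 _ 1); rewrite Pd_pentagonal.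
have Ck := triangular_double k.
have kn : (k < n)%N by lia.
have -> : (n == 0%N) = false by lia.
rewrite add0r (bigD1_seq k) ?mem_index_iota ?iota_uniq //= big1 ?addr0 => [|j jk].
  (* The two values at the same [k] differ by [k.+1], so [n] equals only one of them. *)
  have -> : (n == 3 * 'C(k.+1, 2) + k.+1)%N = (n != 3 * 'C(k.+1, 2) + 2 * k.+1)%N by lia.
  by case: eqP => _; rewrite ?addr0 ?add0r.
have Cj := triangular_double j.
have -> : (n == 3 * 'C(j.+1, 2) + 2 * j.+1)%N = false by case: nk => nk; nia.
have -> : (n == 3 * 'C(j.+1, 2) + j.+1)%N = false by case: nk => nk; nia.
by rewrite addr0.
Qed.

Theorem theorem1p8 (n : nat) :
  R3 n = O2bar n
  /\ O2bar n = Pd n %[mod 2]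
  /\ ((exists m : int, Posz n = ((m * (3 * m - 1))%R %/ 2)%Z) ->
        Pd n = 1 %[mod 2])
  /\ ((forall m : int, Posz n <> ((m * (3 * m - 1))%R %/ 2)%Z) ->
        Pd n = 0 %[mod 2]).
Proof.
split; first exact: R3_O2bar.
split; first by rewrite -R3_O2bar R3_Pd_mod2.
split=> [[m nm]|nm].
  (* The index 0 gives n = 0, a positive [m] gives the first family of exponents, and a negative [m]
     gives the second. *)
  case: m nm => [[|k]|k] nm.
  - have -> : n = 0%N by lia.
    by apply/(eq_F2_mod2 _ 1); rewrite Pd_pentagonal big_geq ?addr0.
  - apply: (@Pd_pentagonal_index _ k); left.
    by have := triangular_double k; nia.
  - apply: (@Pd_pentagonal_index _ k); right.
    by have := triangular_double k; nia.
apply/(eq_F2_mod2 _ 0); rewrite Pd_pentagonal.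
(* Zero is itself pentagonal, with index 0. *)
have -> : (n == 0%N) = false by have := nm 0; lia.
rewrite add0r big1 // => k _.
have Ck := triangular_double k.
have -> : (n == 3 * 'C(k.+1, 2) + k.+1)%N = false.
  apply/eqP => nk; apply: (nm (Posz k.+1)); nia.
have -> : (n == 3 * 'C(k.+1, 2) + 2 * k.+1)%N = false.
  apply/eqP => nk; apply: (nm (- Posz k.+1)); nia.
by rewrite addr0.
Qed.
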